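(* Let $F$ be a field in which $m\ne0$, let $I=\{1,\dots,m\}$, let $a$ be a uniformly distributed associative binary operation on $I$, and consider the Maksimov multiplication $*_a$ of $m\times m\times m$ cubic matrices over $F$. Take arbitrary functions $f_i,g_i:\mathbb R\to F$, $i=1,\dots,m$, such that $$\sum_{k=1}^m f_k(t)g_k(t)=\frac1m\qquad\text{for any }t\in\mathbb R.$$ Then the family of cubic matrices $\mathcal M^{[s,t]}=\left(f_i(s)g_k(t)\right)_{i,j,k=1}^m$ (whose entries do not depend on the middle index $j$) generates a flow of algebras (FA) of type $a$.
   Context: A cubic matrix over $F$ is an array $(a_{ijk})_{i,j,k=1}^m$ with entries in $F$. For an associative binary operation $a:I\times I\to I$, the Maksimov multiplication $*_a$ is the bilinear multiplication of cubic matrices for which, given $A=(a_{ijk})$ and $B=(b_{ijk})$, the product $A*_aB=(c_{ijk})$ is $$c_{ijr}=\sum_{l,n:\,a(l,n)=j}\ \sum_{k=1}^m a_{ilk}b_{knr}.$$ The operation $a$ is uniformly distributed if $\sum_{l,n:\,a(l,n)=j}1=m$ for every $j\in I$, i.e. each $j\in I$ has exactly $m$ preimages under $a$. A family of cubic matrices $\mathcal M^{[s,t]}=(c^{[s,t]}_{ijk})_{i,j,k=1}^m$, $0\le s\le t$ real, generates an FA (flow of algebras) of type $a$ if it satisfies the Kolmogorov-Chapman equation $\mathcal M^{[s,t]}=\mathcal M^{[s,\tau]}*_a\mathcal M^{[\tau,t]}$ for all $0\le s<\tau<t$; the FA is then the family of $m$-dimensional algebras $\mathcal A^{[s,t]}$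 over $F$ with basis $e_1,\dots,e_m$ and products $e_ie_j=\sum_{k=1}^m c^{[s,t]}_{ijk}e_k$. *)

(* Defs.v *)
(* Time ranges over an arbitrary model [R : realType] of the real numbers. *)
From mathcomp Require Import all_boot all_order all_algebra.
From mathcomp Require Import reals.

Set Implicit Arguments.
Unset Strict Implicit.
Unset Printing Implicit Defensive.

Import GRing.Theory.

Local Open Scope ring_scope.

(* The index set {1, ..., m} is rendered as 'I_m = {0, ..., m-1};
   the entry a_ijk of A is A (i, j, k). *)
Definition cubic_matrix (F : fieldType) (m : nat) : Type :=
  {ffun 'I_m * 'I_m * 'I_m -> F}.

Definition cubic_mx (F : fieldType) (m : nat) (c : 'I_m -> 'I_m -> 'I_m -> F) :
  cubic_matrix F m := [ffun x => c x.1.1 x.1.2 x.2].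

Definition maksimov_mul (F : fieldType) (m : nat) (a : 'I_m -> 'I_m -> 'I_m)
    (A B : cubic_matrix F m) : cubic_matrix F m :=
  cubic_mx (fun i j r =>
    \sum_(p : 'I_m * 'I_m | a p.1 p.2 == j)
      \sum_(k < m) A (i, p.1, k) * B (k, p.2, r)).

Definition uniformly_distributed (m : nat) (a : 'I_m -> 'I_m -> 'I_m) : Prop :=
  forall j : 'I_m, (\sum_(p : 'I_m * 'I_m | a p.1 p.2 == j) 1)%N = m.

(* A family indexed by 0 <= s <= t is given as a total function of (s, t);
   only its values at such pairs are ever constrained. *)
Definition kolmogorov_chapman (R : realType) (F : fieldType) (m : nat)
    (a : 'I_m -> 'I_m -> 'I_m) (M : R -> R -> cubic_matrix F m) : Prop :=
  forall s tau t : R, 0 <= s -> s < tau -> tau < t ->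
    M s t = maksimov_mul a (M s tau) (M tau t).

Definition generates_FA (R : realType) (F : fieldType) (m : nat)
    (a : 'I_m -> 'I_m -> 'I_m) (M : R -> R -> cubic_matrix F m) : Prop :=
  kolmogorov_chapman a M.

(* When [generates_FA a M] holds, the flow of algebras generated by M is the
   family, over 0 <= s <= t, of the algebras on F^m with product
   [algebra_mul (M s t)]. *)
Definition algebra_mul (F : fieldType) (m : nat) (C : cubic_matrix F m)
    (u v : 'rV[F]_m) : 'rV[F]_m :=
  \sum_(i < m) \sum_(j < m)
    (u 0 i * v 0 j) *: \sum_(k < m) C (i, j, k) *: delta_mx 0 k.

(* Main.v *)
Require Import Defs.
From mathcomp Require Import all_boot all_order all_algebra.
From mathcomp Require Import reals ring.

Import GRing.Theory.

Local Open Scope ring_scope.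

(** Since the entries ignore the middle index, every pair in the fibre of [a] over j contributes the
    same amount: at time [tau] the sum over k contracts to 1/m, leaving f_i(s) g_r(t) / m. The fibre
    has m pairs, so the factor 1/m cancels. *)

Theorem theorem3 (R : realType) (F : fieldType) (m : nat)
  (hm : (m%:R : F) != 0)
  (a : 'I_m -> 'I_m -> 'I_m)
  (a_assoc : associative a)
  (a_unif : uniformly_distributed a)
  (f g : 'I_m -> R -> F)
  (hfg : forall t : R, \sum_(k < m) f k t * g k t = 1 / m%:R) :
  generates_FA a (fun s t : R => cubic_mx (fun i j k : 'I_m => f i s * g k t)).
Proof.
move=> s tau t _ _ _; apply/ffunP=> -[[i j] r]; rewrite !ffunE /=.
have inner_sum : \sum_(k < m) f i s * g k tau * (f k tau * g r t)
    = f i s * g r t / m%:R.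
  rewrite -[m%:R^-1]mul1r -(hfg tau) mulr_sumr.
  by apply: eq_bigr => k _; ring.
transitivity (\sum_(p : 'I_m * 'I_m | a p.1 p.2 == j) f i s * g r t / m%:R).
  (* The fibre's cardinality is rewritten as the sum of ones that [a_unif] evaluates to m; [hm] then
     permits the cancellation in F. *)
  by rewrite sumr_const -sum1_card [X in _ *+ X]a_unif -[RHS]mulr_natr divfK.
by apply: eq_bigr => p _; rewrite -inner_sum; apply: eq_bigr => k _; rewrite !ffunE.
Qed.
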